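(* For the $L_1$-approximation of monotone functions, for each fixed dimension $d\in\mathbb{N}$ and $n\to\infty$, we have the asymptotic behaviour $$e^{\mathrm{ran}}(n,F_{\mathrm{mon}}^d)\;\asymp\;e^{\mathrm{det}}(n,F_{\mathrm{mon}}^d)\;\asymp\;n^{-1/d},$$ where the implicit constants depend on $d$.
   Context: For $\mathbf{x},\tilde{\mathbf{x}}\in\mathbb{R}^d$ write $\mathbf{x}\le\tilde{\mathbf{x}}$ iff $x_j\le\tilde x_j$ for all $j=1,\dots,d$. Let $F_{\mathrm{mon}}^d=\{f:[0,1]^d\to[-1,1]\mid \mathbf{x}\le\tilde{\mathbf{x}}\Rightarrow f(\mathbf{x})\le f(\tilde{\mathbf{x}})\}$. The task is to approximate $f\in F_{\mathrm{mon}}^d$ in $L_1([0,1]^d)$ (Lebesgue measure) from function values. A deterministic algorithm using $n\in\mathbb{N}_0$ function values is a map $A_n=\phi\circ N:F_{\mathrm{mon}}^d\to L_1([0,1]^d)$ with $N(f)=(f(\mathbf{x}_1),\dots,f(\mathbf{x}_n))\in\mathbb{R}^n$, where the nodes may be chosen adaptively ($\mathbf{x}_i$ may depend on $f(\mathbf{x}_1),\dots,f(\mathbf{x}_{i-1})$), and $\phi:\mathbb{R}^n\to L_1([0,1]^d)$ is any map. Its error is $e(A_n,F_{\mathrm{mon}}^d)=\sup_{f\in F_{\mathrm{mon}}^d}\|A_n(f)-f\|_{L_1}$. A Monte Carlo method $(A_n^{\omega})_{\omega\in\Omega}$ is a family of such maps indexed by a random element $\omega$ of a probability space $(\Omega,\Sigma,\mathbb{P})$,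 with sufficient measurability for the error $e((A_n^\omega),F_{\mathrm{mon}}^d)=\sup_{f\in F_{\mathrm{mon}}^d}\mathbb{E}\,\|A_n^{\omega}(f)-f\|_{L_1}$ to be well defined. The minimal errors are $$e^{\mathrm{det}}(n,F_{\mathrm{mon}}^d)=\inf_{A_n}e(A_n,F_{\mathrm{mon}}^d),\qquad e^{\mathrm{ran}}(n,F_{\mathrm{mon}}^d)=\inf_{(A_n^\omega)}e((A_n^\omega),F_{\mathrm{mon}}^d).$$ Notation: $a_n\preceq b_n$ means that there is a constant $C>0$ (independent of $n$, possibly depending on $d$) with $a_n\le C\,b_n$; $a_n\asymp b_n$ means $a_n\preceq b_n$ and $b_n\preceq a_n$. *)

(* Defs.v *)
From HB Require Import structures.
From mathcomp Require Import all_boot all_order all_algebra.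
From mathcomp Require Import all_classical all_reals all_analysis.
From mathcomp Require Import measurable_realfun.

Set Implicit Arguments.
Unset Strict Implicit.
Unset Printing Implicit Defensive.

Import Order.TTheory GRing.Theory Num.Theory.
Import numFieldNormedType.Exports.

Local Open Scope classical_set_scope.
Local Open Scope ring_scope.

Section power_measure.
Context {p : measure_display} {T : measurableType p} {R : realType}.
Variable m : {sigma_finite_measure set T -> \bar R}.

Definition cons_pair (n : nat) (z : T * n.-tuple T) : n.+1.-tuple T :=
  [tuple of z.1 :: z.2].

Lemma measurable_cons_pair (n : nat) :
  measurable_fun [set: T * n.-tuple T] (@cons_pair n).
Proof. exact: measurable_cons. Qed.

Section step.
Variables (n : nat)
  (mu : {sigma_finite_measure set (n.-tuple T) -> \bar R}).

Definition power_step : set (n.+1.-tuple T) -> \bar R :=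
  pushforward (m \x mu)%E (@cons_pair n).

Let power_step0 : power_step set0 = 0%E.
Proof. by rewrite /power_step /pushforward preimage_set0 measure0. Qed.

Let power_step_ge0 A : (0 <= power_step A)%E.
Proof. by rewrite /power_step /pushforward; exact: measure_ge0. Qed.

Lemma measurable_preimage_cons_pair (A : set (n.+1.-tuple T)) :
  measurable A -> measurable (@cons_pair n @^-1` A).
Proof.
by move=> mA; rewrite -[X in measurable X]setTI; exact: measurable_cons_pair.
Qed.

Let power_step_sigma_additive : semi_sigma_additive power_step.
Proof.
move=> F mF tF mUF; rewrite /power_step /pushforward preimage_bigcup.
apply: measure_semi_sigma_additive.
- by move=> k; exact: measurable_preimage_cons_pair.
- apply/trivIsetP => /= i j _ _ ij; rewrite -preimage_setI.
  by move/trivIsetP : tF => /(_ i j) -> //; rewrite preimage_set0.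
- by rewrite -preimage_bigcup; exact: measurable_preimage_cons_pair.
Qed.

HB.instance Definition _ := isMeasure.Build _ _ _ power_step
  power_step0 power_step_ge0 power_step_sigma_additive.

Let power_step_sigma_finite : sigma_finite setT power_step.
Proof.
have [F UF Ffin] : sigma_finite setT (m \x mu)%E.
  have /sigma_finiteP[F [TF ndF Foo]] := sigma_finiteT m.
  have /sigma_finiteP[G [TG ndG Goo]] := sigma_finiteT mu.
  exists (fun k => F k `*` G k).
    rewrite -setXTT TF TG predeqE => -[x y]; split.
      move=> [/= [i _ Fix] [j _ Gjy]]; exists (maxn i j) => //; split.
      - by move: x Fix; exact/subsetPset/ndF/leq_maxl.
      - by move: y Gjy; exact/subsetPset/ndG/leq_maxr.
    by move=> [i _ []/= ? ?]; split; exists i.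
  move=> k; have [? ?] := Foo k; have [? ?] := Goo k.
  split; first exact: measurableX.
  by rewrite product_measure1E// lte_mul_pinfty// ge0_fin_numE.
pose uncons (t : n.+1.-tuple T) : T * n.-tuple T := (thead t, [tuple of behead t]).
have unconsK : cancel (@cons_pair n) uncons.
  by move=> [x t]; rewrite /uncons /cons_pair/= theadE; congr pair; apply: val_inj.
have muncons : measurable_fun setT uncons.
  apply/measurable_fun_pair; first exact: measurable_tnth.
  exact: measurable_behead.
exists (fun k => uncons @^-1` F k).
  by rewrite -preimage_bigcup -UF preimage_setT.
move=> k; have [mFk Fkoo] := Ffin k; split.
  by rewrite -[X in measurable X]setTI; exact: muncons.
rewrite /power_step /pushforward -comp_preimage.
by rewrite (_ : uncons \o _ = id) //; apply/funext => z; exact: unconsK.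
Qed.

HB.instance Definition _ := @Measure_isSigmaFinite.Build _ _ _ power_step
  power_step_sigma_finite.

End step.

(* The n-fold product measure m \x ... \x m on n-tuples. *)
Fixpoint power_measure (n : nat) :
    {sigma_finite_measure set (n.-tuple T) -> \bar R} :=
  match n with
  | 0%N => \d_([tuple] : 0.-tuple T)
  | k.+1 => power_step (power_measure k)
  end.

End power_measure.

Section approximation.
Variables (R : realType) (d : nat).

(* Lebesgue measure on R^d, completed: for d >= 2 a monotone function is
   Lebesgue measurable but need not be Borel measurable. *)
Definition lebesgue_tuple :=
  @completed_measure_extension _ _ _ (power_measure (@lebesgue_measure R) d).

Definition cube : set (d.-tuple R) :=
  [set x | forall j, 0 <= tnth x j <= 1].

Definition tuple_le (x y : d.-tuple R) := forall j, tnth x j <= tnth y j.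

(* Functions on the cube are total functions on R^d; the values outside the
   cube are unconstrained, and neither the algorithms nor L1_dist see them. *)
Definition Fmon : set (d.-tuple R -> R) :=
  [set f | (forall x, cube x -> -1 <= f x <= 1) /\
           (forall x y, cube x -> cube y -> tuple_le x y -> f x <= f y)].

(* Representatives of the classes in L_1([0,1]^d): L1_dist depends only on the
   classes modulo equality almost everywhere on the cube. *)
Record L1_cube := {
  L1_fun :> d.-tuple R -> R ;
  L1_integrable : lebesgue_tuple.-integrable cube (EFin \o L1_fun) }.

Definition L1_dist (g f : d.-tuple R -> R) : \bar R :=
  (\int[lebesgue_tuple]_(x in cube) `|g x - f x|%:E)%E.

(* node y is the point queried after the i values y have been observed;
   only the nodes with i < n are used. *)
Record algorithm (n : nat) := {
  node : forall i : nat, i.-tuple R -> d.-tuple R ;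
  node_cube : forall (i : nat) (y : i.-tuple R), cube (node y) ;
  recon : n.-tuple R -> L1_cube }.

Fixpoint info (nd : forall i : nat, i.-tuple R -> d.-tuple R)
    (f : d.-tuple R -> R) (n : nat) : n.-tuple R :=
  match n with
  | 0%N => [tuple]
  | i.+1 => let y := info nd f i in [tuple of rcons y (f (nd i y))]
  end.

Definition run (n : nat) (A : algorithm n) (f : d.-tuple R -> R) : L1_cube :=
  recon A (info (@node n A) f n).

Definition det_error (n : nat) (A : algorithm n) : \bar R :=
  ereal_sup [set L1_dist (run A f) f | f in Fmon].

Definition e_det (n : nat) : \bar R := ereal_inf (range (@det_error n)).

Definition mc_measurable (p : measure_display) (Omega : measurableType p)
    (n : nat) (A : Omega -> algorithm n) :=
  forall f, Fmon f -> measurable_fun setT (fun w => L1_dist (run (A w) f) f).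

Definition mc_error (p : measure_display) (Omega : measurableType p)
    (P : probability Omega R) (n : nat) (A : Omega -> algorithm n) : \bar R :=
  ereal_sup [set (\int[P]_w L1_dist (run (A w) f) f)%E | f in Fmon].

Definition e_ran (n : nat) : \bar R :=
  ereal_inf [set e | exists (p : measure_display) (Omega : measurableType p)
    (P : probability Omega R) (A : Omega -> algorithm n),
    mc_measurable A /\ e = mc_error P A].

End approximation.

Section asymptotics.
Variable R : realType.
Implicit Types a b : nat -> \bar R.

Definition preceq a b := exists C : R, 0 < C /\
  forall n : nat, (0 < n)%N -> (a n <= C%:E * b n)%E.

Definition asymp a b := preceq a b /\ preceq b a.

End asymptotics.

(* Main.v *)
(* Cut the cube into [N^d] congruent cells. Sampling a monotone f at the lower
   corners, the error is at most [N^-d] times the sum over the cells of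
   f(upper corner) - f(lower corner), which telescopes along diagonals and is
   therefore at most [2 d N^(d-1)]. Conversely, the functions that are constant
   on cells with values [(2 (i_1 + ... + i_d) +- 1) / (d N)], up to a shift, are
   monotone for every choice of signs; n function values reveal at most n signs,
   and on a cell whose sign is not revealed the two possible values are
   [2 / (d N)] apart, so that for [2 n <= N^d] every algorithm has average error
   at least [1 / (2 d N)] over the signs, and this average bounds the error of
   Monte Carlo methods from below. *)
Require Import Defs.
From mathcomp Require Import all_boot all_order all_algebra.
From mathcomp Require Import all_classical all_reals all_analysis.
From mathcomp Require Import measurable_realfun ring lra.
Import Order.TTheory GRing.Theory Num.Theory.
Set Implicit Arguments.
Unset Strict Implicit.
Unset Printing Implicit Defensive.
Local Open Scope ring_scope.

(** * Monotonicity of the integral of nonnegative functions *)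

Section lower_integral.
Local Open Scope classical_set_scope.
Context {dsp} {T : measurableType dsp} {R : realType}.
Variable mu : {measure set T -> \bar R}.

(* The integral of a nonnegative function is the supremum of the integrals of
   the simple functions below it, hence monotone without any measurability; this
   avoids proving that monotone functions are Lebesgue measurable. *)
Lemma ge0_le_integral_nomeas (D : set T) (f g : T -> \bar R) :
  (forall x, D x -> (0 <= f x)%E) -> (forall x, D x -> (f x <= g x)%E) ->
  (\int[mu]_(x in D) f x <= \int[mu]_(x in D) g x)%E.
Proof.
move=> f0 fg; have g0 x : D x -> (0 <= g x)%E.
  by move=> Dx; exact: le_trans (f0 _ Dx) (fg _ Dx).
rewrite !ge0_integralE //=; apply: ge_ereal_sup => _ [h /= hf <-].
apply: ereal_sup_ubound; exists h => // x; apply: le_trans (hf x) _.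
by rewrite /patch; case: ifPn => // /set_mem /fg.
Qed.

End lower_integral.

(** * Boxes and their product measure *)

Section box.
Local Open Scope classical_set_scope.

Definition box {T : Type} (d : nat) (A : 'I_d -> set T) : set (d.-tuple T) :=
  [set x | forall j, A j (tnth x j)].

Context {dsp} {T : measurableType dsp} {R : realType}.

Lemma measurable_box d (A : 'I_d -> set T) :
  (forall j, measurable (A j)) -> measurable (box A).
Proof.
move=> mA; rewrite (_ : box A = \bigcap_(j in setT) ((tnth (T:=T))^~ j @^-1` A j)).
  apply: fin_bigcap_measurable => // j _; rewrite -[X in measurable X]setTI.
  exact: measurable_tnth.
by apply/seteqP; split => x /=; [move=> h j _; exact: h|move=> h j; exact: h].
Qed.

(** By induction on [d]: the preimage of a box under [cons_pair] is the product of its first side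
    and the box of the remaining sides. *)
Lemma power_measure_box (m : {sigma_finite_measure set T -> \bar R}) d
    (A : 'I_d -> set T) : (forall j, measurable (A j)) ->
  (power_measure m d (box A) = \prod_j m (A j))%E.
Proof.
elim: d A => [|d IH] A mA.
  by rewrite big_ord0 /= diracE mem_set //= => -[].
rewrite big_ord_recl -IH => [|j]; last exact: mA.
rewrite -product_measure1E //; last exact: measurable_box.
rewrite /= /power_step /pushforward; congr (_ _).
apply/seteqP; split => -[x t] /=.
  by move=> h; split => [|j]; [have := h ord0|have := h (lift ord0 j)];
     rewrite ?tnth0 ?tnthS.
move=> [Ax At] j; rewrite /cons_pair /=.
by case: (unliftP ord0 j) => [k ->|->]; rewrite ?tnth0 ?tnthS //; exact: At.
Qed.

End box.

(** * The grid cells and their Lebesgue measure *)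

Section cells.
Local Open Scope classical_set_scope.
Variables (R : realType) (N : nat).

(* The grid has [N.+1] segments per axis; the last one is closed, as [minn]
   sends the endpoint 1 to it. *)
Definition coord_idx (t : R) : 'I_N.+1 :=
  inord (minn (Num.truncn (N.+1%:R * t)) N).

Lemma coord_idxE t : coord_idx t = minn (Num.truncn (N.+1%:R * t)) N :> nat.
Proof. by rewrite inordK // ltnS geq_minr. Qed.

Lemma le_coord_idx s t : s <= t -> (coord_idx s <= coord_idx t)%N.
Proof.
move=> st; rewrite !coord_idxE leq_min geq_minr andbT.
apply: leq_trans (geq_minl _ _) _.
by apply: le_truncn; rewrite ler_pM2l ?ltr0n.
Qed.

Definition segment (k : 'I_N.+1) : set R :=
  [set t | 0 <= t <= 1 /\ coord_idx t = k].

(** As a right endpoint, [BSide true] excludes the point and [BSide false] includes it, so exactly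
    the last segment is closed on the right. *)
Lemma segmentE k : segment k =
  [set` Interval (BLeft (k%:R / N.+1%:R))
                 (BSide (k != N :> nat) (k.+1%:R / N.+1%:R))].
Proof.
have N0 : 0 < N.+1%:R :> R by rewrite ltr0n.
have kN : (k <= N)%N by rewrite -ltnS.
have kE t : (coord_idx t = k) <-> (minn (Num.truncn (N.+1%:R * t)) N = k).
  by split => [<-|h]; [rewrite coord_idxE|apply/val_inj; rewrite /= coord_idxE].
apply/seteqP; split => t /=; rewrite in_itv /= ler_pdivrMr // [t * _]mulrC.
  move=> [/andP[t0 t1]] /kE; have Nt0 : 0 <= N.+1%:R * t by rewrite mulr_ge0 // ltW.
  have [tN|Nt] := ltnP (Num.truncn (N.+1%:R * t)) N => kt.
    rewrite -kt (ltn_eqF tN) /= ltr_pdivlMr // [t * _]mulrC.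
    exact: truncn_itv.
  rewrite -kt eqxx /= divff ?gt_eqF // t1 andbT.
  by rewrite -truncn_ge_nat.
move=> /andP[kt tk].
have t0 : 0 <= t by rewrite -(pmulr_rge0 _ N0); apply: le_trans kt.
have Nt0 : 0 <= N.+1%:R * t by rewrite mulr_ge0 // ltW.
have t1 : t <= k.+1%:R / N.+1%:R by move: tk; case: (_ != _) => //= /ltW.
split; first by rewrite t0 (le_trans t1) // ler_pdivrMr // mul1r ler_nat ltnS.
apply/kE; move: tk; have [kN'|kN'] := eqVneq (k : nat) N; rewrite /=.
  move=> _; rewrite kN'; apply/minn_idPr.
  by rewrite truncn_ge_nat // -[X in X%:R <= _]kN'.
rewrite ltr_pdivlMr // [t * _]mulrC => tk.
have -> : Num.truncn (N.+1%:R * t) = k by apply: truncn_def; rewrite kt tk.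
exact/minn_idPl.
Qed.

Lemma measurable_segment k : measurable (segment k).
Proof. by rewrite segmentE; exact: measurable_itv. Qed.

Lemma lebesgue_measure_segment k :
  lebesgue_measure (segment k) = (N.+1%:R^-1)%:E.
Proof.
rewrite segmentE lebesgue_measure_itv /= lte_fin ltr_pM2r ?invr_gt0 ?ltr0n //.
by rewrite ltr_nat ltnSn -EFinB -mulrBl -natrB // subSnn mul1r.
Qed.

Variable d : nat.
Implicit Types (i : {ffun 'I_d -> 'I_N.+1}) (x y : d.-tuple R).

Definition cell_idx x : {ffun 'I_d -> 'I_N.+1} :=
  [ffun j => coord_idx (tnth x j)].

Definition cell i : set (d.-tuple R) := [set x | cube x /\ cell_idx x = i].

Lemma cellE i : cell i = box (fun j => segment (i j)).
Proof.
apply/seteqP; split => x /= => [[cx <-] j|h].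
  by split; [exact: cx|rewrite ffunE].
split => [j|]; first by have [] := h j.
by apply/ffunP => j; rewrite ffunE; have [] := h j.
Qed.

Let mu := @lebesgue_tuple R d.

(** The Caratheodory sigma-algebra is the domain of the completed measure; it contains the product
    sigma-algebra, to which boxes of intervals belong. *)
Lemma measurable_cell i :
  (power_measure (@lebesgue_measure R) d)^*%mu.-cara.-measurable (cell i).
Proof.
apply: caratheodory_measurable_mu_ext.
by rewrite cellE; apply: measurable_box => j; exact: measurable_segment.
Qed.

Lemma measure_cell i : mu (cell i) = (N.+1%:R ^- d)%:E.
Proof.
have ms j := measurable_segment (i j).
rewrite /mu /lebesgue_tuple /completed_measure_extension measurable_mu_extE; last first.
  by rewrite cellE; exact: measurable_box.
rewrite cellE; etransitivity; first exact: power_measure_box.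
rewrite (eq_bigr (fun=> (N.+1%:R^-1)%:E)) => [|j _].
  by rewrite prodEFin prodr_const card_ord exprVn.
exact: lebesgue_measure_segment.
Qed.

End cells.

(** * Integration over a set cut into finitely many measurable fibers *)

Section finite_fibers.
Local Open Scope classical_set_scope.
Context {dsp} {T : measurableType dsp} {R : realType}.
Variables (mu : {measure set T -> \bar R}) (I : finType) (idx : T -> I).
Variable D : set T.

Let C i := [set x | D x /\ idx x = i].
Hypothesis mC : forall i, measurable (C i).

Let DE : D = \big[setU/set0]_i C i.
Proof.
apply/seteqP; split => x /=; rewrite -bigcup_seq.
  by move=> Dx; exists (idx x); rewrite //= mem_index_enum.
by move=> -[i _] [].
Qed.

Lemma measurable_fibers : measurable D.
Proof. by rewrite DE; exact: bigsetU_measurable. Qed.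

Lemma measurable_fun_fibers dsp' (T' : measurableType dsp') (g : T -> T') :
  (forall i, measurable_fun (C i) g) -> measurable_fun D g.
Proof.
move=> mg _ Y mY; rewrite DE -bigcup_seq setI_bigcupl.
apply: fin_bigcup_measurable => // i _; exact: mg.
Qed.

Lemma ge0_integral_fibers (g : T -> \bar R) :
  measurable_fun D g -> (forall x, D x -> 0 <= g x)%E ->
  (\int[mu]_(x in D) g x = \sum_i \int[mu]_(x in C i) g x)%E.
Proof.
move=> mg g0; rewrite {1}DE ge0_integral_bigsetU -?DE // ?index_enum_uniq //.
by move=> i j _ _ [x /= [[_ <-] [_ <-]]].
Qed.

Lemma measurable_step (c : I -> R) : measurable_fun D (c \o idx).
Proof.
apply: measurable_fun_fibers => i.
by apply: (eq_measurable_fun (cst (c i))) => // x; rewrite inE => -[_ /= ->].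
Qed.

Lemma ge0_integral_step (c : I -> R) : (forall i, 0 <= c i) ->
  (\int[mu]_(x in D) (c (idx x))%:E = \sum_i (c i)%:E * mu (C i))%E.
Proof.
move=> c0; rewrite ge0_integral_fibers; last first.
- by move=> x _; rewrite lee_fin.
- by apply/measurable_EFinP; exact: measurable_step.
apply: eq_bigr => i _; rewrite -integral_cst //; apply: eq_integral => x.
by rewrite inE => -[_ /= ->].
Qed.

Lemma integral_dist_step (g : T -> R) (c : I -> R) : measurable_fun D g ->
  (\int[mu]_(x in D) `|g x - c (idx x)|%:E =
   \sum_i \int[mu]_(x in C i) `|g x - c i|%:E)%E.
Proof.
move=> mg; rewrite ge0_integral_fibers => [||x _]; last by rewrite lee_fin.
- by apply: eq_bigr => i _; apply: eq_integral => x; rewrite inE => -[_ <-].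
- apply/measurable_EFinP/measurableT_comp => //; apply: measurable_funB => //.
  exact: measurable_step.
Qed.

Lemma integrable_step (c : I -> R) : (forall i, mu (C i) < +oo)%E ->
  mu.-integrable D (EFin \o (c \o idx)).
Proof.
move=> Cfin; apply/integrableP; split.
  by apply/measurable_EFinP; exact: measurable_step.
rewrite (_ : (\int[mu]_(x in D) _ = \sum_i `|c i|%:E * mu (C i))%E); last first.
  by rewrite -ge0_integral_step.
by apply: lte_sum_pinfty => i _; rewrite lte_mul_pinfty ?lee_fin.
Qed.

(** Only the dominating step function is split over the fibers. The absolute values guard against
    empty fibers, the only ones where [c] may be negative. *)
Lemma le_integral_step (f : T -> \bar R) (c : I -> R) :
  (forall x, D x -> 0 <= f x)%E -> (forall x, D x -> f x <= (c (idx x))%:E)%E ->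
  (\int[mu]_(x in D) f x <= \sum_i `|c i|%:E * mu (C i))%E.
Proof.
move=> f0 fc; rewrite -ge0_integral_step //; apply: ge0_le_integral_nomeas => //.
by move=> x Dx; apply: le_trans (fc _ Dx) _; rewrite lee_fin ler_norm.
Qed.

End finite_fibers.

(** * No function is close to two distant constants *)

Section two_constants.
Local Open Scope classical_set_scope.
Context {dsp} {T : measurableType dsp} {R : realType}.
Variable mu : {measure set T -> \bar R}.

(** The triangle inequality through [g x], integrated over [E]. *)
Lemma le_integral_dist_csts (E : set T) (g : T -> R) (a b : R) :
  measurable E -> measurable_fun E g ->
  (`|a - b|%:E * mu E <=
   \int[mu]_(x in E) `|g x - a|%:E + \int[mu]_(x in E) `|g x - b|%:E)%E.
Proof.
move=> mE mg.
have mgc c : measurable_fun E (fun x => `|g x - c|%:E).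
  by apply/measurable_EFinP/measurableT_comp => //; apply: measurable_funB.
rewrite -integral_cst // -ge0_integralD //.
apply: ge0_le_integral_nomeas => [x _|x _]; rewrite /= ?lee_fin //.
by rewrite -(distrC a) (le_trans _ (ler_normD _ _)) // addrA subrK.
Qed.

End two_constants.

(** * Corners of the cells and the telescoping sum *)

Section grid.
Local Open Scope classical_set_scope.
Variables (R : realType) (N d : nat).
Implicit Types (i : {ffun 'I_d -> 'I_N.+1}) (x : d.-tuple R).

Definition lower_corner i : d.-tuple R := [tuple (i j)%:R / N.+1%:R | j < d].

Definition upper_corner i : d.-tuple R :=
  [tuple (i j).+1%:R / N.+1%:R | j < d].

Let N0 : 0 < N.+1%:R :> R. Proof. by rewrite ltr0n. Qed.

Lemma lower_corner_cube i : cube (lower_corner i).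
Proof.
move=> j; rewrite tnth_mktuple divr_ge0 //= ler_pdivrMr // mul1r.
by rewrite ler_nat ltnW.
Qed.

Lemma upper_corner_cube i : cube (upper_corner i).
Proof.
by move=> j; rewrite tnth_mktuple divr_ge0 //= ler_pdivrMr // mul1r ler_nat.
Qed.

Lemma cell_corners x : cube x ->
  tuple_le (lower_corner (cell_idx N x)) x /\
  tuple_le x (upper_corner (cell_idx N x)).
Proof.
move=> cx; have h j : (coord_idx N (tnth x j))%:R / N.+1%:R <= tnth x j
    <= (coord_idx N (tnth x j)).+1%:R / N.+1%:R.
  have : segment (coord_idx N (tnth x j)) (tnth x j) by split; first exact: cx.
  rewrite segmentE /= in_itv /= => /andP[-> +] /=.
  by case: (_ != _) => // /ltW.
by split => j; rewrite tnth_mktuple ffunE; have /andP[] := h j.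
Qed.

Lemma Fmon_corners (f : d.-tuple R -> R) i : Fmon f ->
  0 <= f (upper_corner i) - f (lower_corner i) <= 2.
Proof.
move=> [fb fm]; apply/andP; split.
  rewrite subr_ge0; apply: fm => [||j]; rewrite ?tnth_mktuple.
  - exact: lower_corner_cube.
  - exact: upper_corner_cube.
  - by rewrite ler_pM2r ?invr_gt0 // ler_nat.
have := fb _ (lower_corner_cube i); have := fb _ (upper_corner_cube i); lra.
Qed.

(** The factor [N.+1] avoids the exponent [d - 1]. The indicator is a product over the coordinates,
    so its sum over all indices is a product of sums. *)
Lemma card_ffun_coord (j : 'I_d) (k : 'I_N.+1) :
  (N.+1 * \sum_(i : {ffun 'I_d -> 'I_N.+1}) (i j == k) = N.+1 ^ d)%N.
Proof.
pose G l a : nat := if l == j then (a == k :> 'I_N.+1) : nat else 1%N.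
rewrite (eq_bigr (fun i : {ffun _} => \prod_l G l (i l))%N) => [|i _]; last first.
  by rewrite (bigD1 j) //= big1 ?muln1 /G ?eqxx // => l /negbTE ->.
rewrite -bigA_distr_bigA (bigD1 j) //= {1}/G eqxx.
rewrite (bigD1 k) //= eqxx big1 ?addn0 ?mul1n; last by move=> a /negbTE ->.
rewrite (eq_bigr (fun=> N.+1)) => [|l lj].
  by rewrite prod_nat_const cardC1 card_ord -expnS prednK // (leq_ltn_trans _ (ltn_ord j)).
by rewrite /G (negbTE lj) sum1_card card_ord.
Qed.

(* With [s] the cyclic shift of all coordinates, [upper_corner i] is the lower
   corner of [s i] unless some coordinate of [i] is maximal; reindexing the
   lower corners along [s] leaves only the latter terms. *)
Lemma sum_corners_le (f : d.-tuple R -> R) : Fmon f ->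
  \sum_i (f (upper_corner i) - f (lower_corner i)) <=
  (2 * d%:R / N.+1%:R) * N.+1%:R ^+ d.
Proof.
move=> fmon.
pose s i : {ffun 'I_d -> 'I_N.+1} := [ffun j => ordS (i j)].
have s_inj : injective s.
  move=> i i' /ffunP ss; apply/ffunP => j.
  by have := ss j; rewrite !ffunE => /ordS_inj.
rewrite sumrB [X in _ - X](reindex_inj s_inj) /= -sumrB.
(* Every maximal coordinate is charged 2, the largest possible difference of two values of [f];
   without maximal coordinates the term vanishes. *)
apply: (@le_trans _ _ (\sum_(i : {ffun 'I_d -> 'I_N.+1}) \sum_j 2 * (i j == ord_max)%:R)).
  apply: ler_sum => i _.
  have [/forallP imax|] := boolP [forall j, i j != ord_max].
    rewrite (_ : lower_corner (s i) = upper_corner i) ?subrr; last first.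
      apply: eq_from_tnth => j; rewrite !tnth_mktuple ffunE /= modn_small //.
      have := imax j; rewrite -val_eqE /= => ij.
      by rewrite ltn_neqAle ltn_ord andbT eqSS.
    by apply: sumr_ge0 => j _; rewrite mulr_ge0.
  rewrite negb_forall => /existsP[j]; rewrite negbK => ij.
  apply: (@le_trans _ _ 2).
    case: fmon => fb _.
    have := fb _ (lower_corner_cube (s i)); have := fb _ (upper_corner_cube i).
    lra.
  rewrite (bigD1 j) //= ij mulr1 lerDl.
  by apply: sumr_ge0 => l _; rewrite mulr_ge0.
rewrite exchange_big /= (eq_bigr (fun=> 2 / N.+1%:R * N.+1%:R ^+ d)) => [|j _].
  by rewrite sumr_const card_ord -mulr_natr le_eqVlt; apply/orP; left; apply/eqP; ring.
rewrite -mulr_sumr -mulrA; congr (_ * _); apply: (mulfI (lt0r_neq0 N0)).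
by rewrite mulVKf ?lt0r_neq0 // -natr_sum -natrM card_ffun_coord natrX.
Qed.

Lemma card_grid : #|{ffun 'I_d -> 'I_N.+1}| = (N.+1 ^ d)%N.
Proof. by rewrite card_ffun !card_ord. Qed.

Lemma measure_cell_fin i : (@lebesgue_tuple R d (cell i) < +oo)%E.
Proof. by rewrite measure_cell ltry. Qed.

Definition step_L1 (c : {ffun 'I_d -> 'I_N.+1} -> R) : L1_cube R d :=
  Build_L1_cube
    (integrable_step (@measurable_cell R N d) c measure_cell_fin).

Lemma L1_dist_step_le (c e : {ffun 'I_d -> 'I_N.+1} -> R) f :
  (forall x, cube x -> `|c (cell_idx N x) - f x| <= e (cell_idx N x)) ->
  (L1_dist (step_L1 c) f <= ((\sum_i `|e i|) / N.+1%:R ^+ d)%:E)%E.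
Proof.
move=> h; rewrite /L1_dist.
have le_int := @le_integral_step _ _ R (@lebesgue_tuple R d) _ (@cell_idx R N d)
  (@cube R d) (@measurable_cell R N d) (fun x => `|c (cell_idx N x) - f x|%:E) e.
apply: le_trans (le_int _ _) _.
- by move=> x _; rewrite lee_fin.
- by move=> x cx; rewrite lee_fin; exact: h.
rewrite (eq_bigr (fun i => (`|e i| / N.+1%:R ^+ d)%:E)) => [|i _].
  by rewrite sumEFin mulr_suml.
by rewrite EFinM; congr (_ * _)%E; exact: measure_cell.
Qed.

End grid.

(** * Upper bound: sampling at the lower corners *)

Section upper_bound.
Local Open Scope classical_set_scope.
Variables (R : realType) (d : nat).

Lemma nth_info nd (f : d.-tuple R -> R) n k : (k < n)%N ->
  nth 0 (info nd f n) k = f (nd k (info nd f k)).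
Proof.
elim: n => // n IH; rewrite ltnS leq_eqVlt => /orP[/eqP->|kn] /=.
  by rewrite nth_rcons size_tuple ltnn eqxx.
by rewrite nth_rcons size_tuple kn IH.
Qed.

(** The nodes are nonadaptive and follow the enumeration of the cells. Queries past its end fall on
    the origin by the default of [nth], so [n] may exceed the number of cells. *)
Definition grid_algorithm N n : algorithm R d n := {|
  node := fun k _ => lower_corner R (nth [ffun=> ord0] (enum {ffun 'I_d -> 'I_N.+1}) k);
  node_cube := fun k _ => lower_corner_cube R _;
  recon := fun y => step_L1 (fun i => nth 0 y (index i (enum {ffun 'I_d -> 'I_N.+1}))) |}.

Lemma run_grid_algorithm N n f x : (N.+1 ^ d <= n)%N ->
  run (grid_algorithm N n) f x = f (lower_corner R (cell_idx N x)).
Proof.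
move=> Nn; rewrite /run /= nth_info ?nth_index ?mem_enum //.
by apply: leq_trans Nn; rewrite -card_grid cardE index_mem mem_enum.
Qed.

Lemma det_error_grid_algorithm N n : (N.+1 ^ d <= n)%N ->
  (det_error (grid_algorithm N n) <= (2 * d%:R / N.+1%:R)%:E)%E.
Proof.
move=> Nn; apply: ge_ereal_sup => _ [f fmon <-].
pose e (i : {ffun 'I_d -> 'I_N.+1}) := f (upper_corner R i) - f (lower_corner R i).
(* On a cell, both [f x] and the sampled value lie between the corner values, whose difference is
   [e]. *)
apply: le_trans (@L1_dist_step_le _ _ _ _ e _ _) _ => [x cx|].
  have := run_grid_algorithm f x Nn; rewrite /run /= => ->.
  have [lx xu] := cell_corners N cx; case: fmon => _ fm.
  have l := fm _ _ (lower_corner_cube R _) cx lx.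
  have u := fm _ _ cx (upper_corner_cube R _) xu.
  by rewrite distrC ger0_norm ?subr_ge0 // /e; lra.
rewrite lee_fin ler_pdivrMr ?exprn_gt0 ?ltr0n //.
rewrite (eq_bigr e) => [|i _]; first exact: sum_corners_le.
by rewrite ger0_norm //; case/andP: (Fmon_corners i fmon).
Qed.

Lemma e_det_le N n : (N.+1 ^ d <= n)%N ->
  (e_det R d n <= (2 * d%:R / N.+1%:R)%:E)%E.
Proof.
move=> Nn; apply: le_trans (det_error_grid_algorithm Nn).
by apply: ereal_inf_lbound; exists (grid_algorithm N n).
Qed.

End upper_bound.

(** * Lower bound: fooling functions with hidden signs *)

Section fooling.
Local Open Scope classical_set_scope.
Variables (R : realType) (N d : nat).
Hypothesis d0 : (0 < d)%N.

Local Notation grid := {ffun 'I_d -> 'I_N.+1}.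
Implicit Types (i q : grid) (eps : {ffun grid -> bool}).

Let dN0 : 0 < (d * N.+1)%:R :> R. Proof. by rewrite ltr0n muln_gt0 d0. Qed.

(* The levels [2 * (\sum_j i j)] are spaced by 2, so that any choice of signs
   keeps the function monotone. *)
Definition fooling_value eps i : R :=
  (2 * (\sum_j i j)%:R - (d * N)%:R + (-1) ^+ eps i) / (d * N.+1)%:R.

Definition fooling eps (x : d.-tuple R) := fooling_value eps (cell_idx N x).

Let sign_bound (b : bool) : `|(-1) ^+ b| <= 1 :> R.
Proof. by rewrite normrX normrN1 expr1n. Qed.

(** The coordinate sum is at most [d * N], so the numerator is at most [d * N + 1 <= d * N.+1] in
    absolute value. *)
Lemma fooling_value_bound eps i : -1 <= fooling_value eps i <= 1.
Proof.
have S_le : (\sum_j i j)%:R <= (d * N)%:R :> R.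
  rewrite ler_nat -[d in leqRHS]card_ord -sum_nat_const.
  by apply: leq_sum => j _; rewrite -ltnS.
have d1 : 1 <= d%:R :> R by rewrite ler1n.
have := sign_bound (eps i); rewrite ler_norml => /andP[s0 s1].
have S0 : 0 <= (\sum_j i j)%:R :> R by [].
have dE : (d * N.+1)%:R = (d * N)%:R + d%:R :> R by rewrite mulnS addnC natrD.
rewrite ler_pdivlMr; last exact: dN0.
rewrite ler_pdivrMr; last exact: dN0.
rewrite dE; move: s0 s1 S0 S_le d1.
set S := (\sum_j i j)%:R; set a := (d * N)%:R; set b := d%:R; set c := _ ^+ _.
by move=> *; apply/andP; split; lra.
Qed.

Lemma fooling_value_homo eps i i' : (forall j, i j <= i' j)%N ->
  fooling_value eps i <= fooling_value eps i'.
Proof.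
move=> ii'; rewrite ler_pM2r ?invr_gt0 //.
have := leqif_sum (fun j (_ : true) => leqif_eq (ii' j)).
(* Equal coordinate sums force [i = i']; otherwise the levels differ by at least 2, which the two
   signs cannot outweigh. *)
move=> [+ SE]; rewrite leq_eqVlt SE => /orP[/forallP h|lt].
  suff -> : i = i' by [].
  by apply/ffunP => j; apply/val_inj/eqP; exact: h.
have := sign_bound (eps i); have := sign_bound (eps i'); rewrite !ler_norml => /andP[a _] /andP[_ b].
have : (\sum_j i j)%:R + 1 <= (\sum_j i' j)%:R :> R by rewrite natr1 ler_nat.
move: a b; set S := (\sum_j i j)%:R; set S' := (\sum_j i' j)%:R.
set s := _ ^+ eps i; set s' := _ ^+ eps i'; set c := (d * N)%:R => *.
lra.
Qed.

Lemma Fmon_fooling eps : Fmon (fooling eps).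
Proof.
split=> [x _|x y _ _ xy]; first exact: fooling_value_bound.
by apply: fooling_value_homo => j; rewrite !ffunE; exact: le_coord_idx.
Qed.

Definition flip q eps : {ffun grid -> bool} :=
  [ffun i => (i == q) (+) eps i].

Lemma flip_inj q : injective (flip q).
Proof.
apply: (can_inj (g := flip q)) => eps.
by apply/ffunP => i; rewrite !ffunE addbA addbb.
Qed.

Lemma fooling_value_flip q eps :
  `|fooling_value eps q - fooling_value (flip q eps) q| = 2 / (d * N.+1)%:R.
Proof.
rewrite /fooling_value -mulrBl normrM [X in _ * X]gtr0_norm ?invr_gt0 //.
congr (_ / _); rewrite ffunE eqxx /=; case: (eps q); rewrite /= expr0 expr1.
  by rewrite (_ : _ - _ = -2 :> R) ?normrN ?ger0_norm //; ring.
by rewrite (_ : _ - _ = 2 :> R) ?ger0_norm //; ring.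
Qed.

Section algo.
Variables (n : nat) (A : algorithm R d n).
Local Notation nd := (@node R d n A).

Definition queried eps : seq grid :=
  [seq cell_idx N (nd (info nd (fooling eps) k)) | k <- iota 0 n].

(** Adaptivity does not help: as long as the answers agree, so does the next node, and it lies
    outside cell [q], where the two functions coincide. *)
Lemma info_flip q eps k : q \notin queried eps -> (k <= n)%N ->
  info nd (fooling (flip q eps)) k = info nd (fooling eps) k.
Proof.
move=> qQ; elim: k => // k IH kn; apply: val_inj => /=.
rewrite IH ?(ltnW kn) //; congr rcons.
rewrite /fooling /fooling_value ffunE [_ == q](negbTE _) //.
apply: contraNneq qQ => <-; apply: map_f.
by rewrite mem_iota add0n.
Qed.

Definition cell_error eps q : \bar R :=
  (\int[@lebesgue_tuple R d]_(x in cell q)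
    `|run A (fooling eps) x - fooling_value eps q|%:E)%E.

Lemma cell_error_ge0 eps q : (0 <= cell_error eps q)%E.
Proof. by apply: integral_ge0 => x _; rewrite lee_fin. Qed.

Let integrable_run eps q :
  (@lebesgue_tuple R d).-integrable (cell q) (EFin \o run A (fooling eps)).
Proof.
apply: (integrableS _ _ _ (L1_integrable (run A (fooling eps)))) => [||x []//].
  exact: measurable_fibers (@measurable_cell R N d).
exact: measurable_cell.
Qed.

Lemma L1_dist_fooling eps :
  L1_dist (run A (fooling eps)) (fooling eps) = (\sum_q cell_error eps q)%E.
Proof.
rewrite /L1_dist; apply: (@integral_dist_step _ _ R (@lebesgue_tuple R d) _
  (@cell_idx R N d) (@cube R d)); first exact: measurable_cell.
exact/measurable_EFinP/measurable_int/L1_integrable.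
Qed.

(** The algorithm returns the same function on both inputs, and it cannot be close to both values on
    [q]. *)
Lemma cell_error_flip q eps : q \notin queried eps ->
  ((2 / (d * N.+1)%:R / N.+1%:R ^+ d)%:E <=
   cell_error eps q + cell_error (flip q eps) q)%E.
Proof.
move=> qQ; rewrite EFinM -(fooling_value_flip q eps).
rewrite -[X in (_ * X <= _)%E](measure_cell _ q).
rewrite /cell_error /run (info_flip qQ (leqnn n)).
apply: le_integral_dist_csts; first exact: measurable_cell.
exact/measurable_EFinP/measurable_int/integrable_run.
Qed.

(* For each cell [q] the sum over [eps] is reindexed along [flip q], pairing
   the two sign choices that the algorithm cannot tell apart. *)
Lemma sum_L1_dist_fooling : (2 * n <= N.+1 ^ d)%N ->
  ((#|{ffun grid -> bool}|%:R * (2 * (d * N.+1)%:R)^-1)%:E <=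
   \sum_eps L1_dist (run A (fooling eps)) (fooling eps))%E.
Proof.
move=> nN; set K := (X in (X%:E <= _)%E); set S := (X in (_ <= X)%E).
set w : R := 2 / (d * N.+1)%:R / N.+1%:R ^+ d.
(* The sum is doubled so that one copy can be reindexed by the flip and paired with the other. *)
suff : ((2 * K)%:E <= S + S)%E.
  have : (0 <= S)%E by apply: sume_ge0 => eps _; apply: integral_ge0 => x _; rewrite lee_fin.
  by case: S => [s| |] //=; rewrite ?leey // -?EFinD !lee_fin; lra.
have -> : S = (\sum_q \sum_eps cell_error eps q)%E.
  by rewrite exchange_big; apply: eq_bigr => eps _; exact: L1_dist_fooling.
rewrite -big_split /=.
apply: (@le_trans _ _ (\sum_q \sum_eps ((q \notin queried eps)%:R * w)%:E)%E).
  rewrite exchange_big /=.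
  apply: (@le_trans _ _ (\sum_(eps : {ffun grid -> bool}) ((d * N.+1)%:R^-1)%:E)%E).
    rewrite sumEFin sumr_const lee_fin -[leRHS]mulr_natl /K invfM.
    by rewrite mulrCA mulVKf.
  apply: lee_sum => eps _; rewrite sumEFin lee_fin -mulr_suml -natr_sum.
  (* At most [n] cells are queried, hence at least half of all cells are not. *)
  have cQ : (N.+1 ^ d <= 2 * \sum_q (q \notin queried eps))%N.
    rewrite (eq_bigr (fun q => if q \in predC (mem (queried eps)) then 1 else 0)%N);
      last by move=> q _; rewrite inE; case: (_ \notin _).
    rewrite -big_mkcond /= sum1_card; move: nN.
    rewrite -card_grid -(cardC (mem (queried eps))) => nN'.
    rewrite mul2n -addnn leq_add2r -(leq_add2l #|mem (queried eps)|) addnn -mul2n.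
    apply: leq_trans nN'; rewrite leq_mul2l /=.
    by rewrite (leq_trans (card_size _)) // size_map size_iota.
  have M0 : 0 < N.+1%:R ^+ d :> R by rewrite exprn_gt0 // ltr0n.
  move: cQ; set c := (\sum_q _)%N => cQ.
  have -> : c%:R * w = (d * N.+1)%:R^-1 * ((2 * c)%:R / N.+1%:R ^+ d).
    by rewrite /w natrM; ring.
  by rewrite ler_pMr ?invr_gt0 // ler_pdivlMr // mul1r -natrX ler_nat.
apply: lee_sum => q _.
rewrite [X in (_ + X)%E](reindex_inj (@flip_inj q)) -big_split /=.
apply: lee_sum => eps _; have [qQ|qQ] := boolP (q \in queried eps).
  by rewrite mul0r adde_ge0 // cell_error_ge0.
by rewrite mul1r; exact: cell_error_flip.
Qed.

End algo.

(** The worst expected error dominates its average over the signs. Exchanging this finite sum with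
    the expectation leaves the deterministic bound for each [w]. *)
Lemma mc_error_ge dsp (Omega : measurableType dsp) (P : probability Omega R) n
    (A : Omega -> algorithm R d n) : mc_measurable A ->
  (2 * n <= N.+1 ^ d)%N -> (((2 * (d * N.+1)%:R)^-1)%:E <= mc_error P A)%E.
Proof.
move=> mA nN; set e := mc_error P A.
set k := (X in (X%:E <= _)%E).
pose F := #|{ffun grid -> bool}|.
have F0 : 0 < F%:R :> R.
  by rewrite ltr0n; apply/card_gt0P; exists [ffun=> true].
have : ((F%:R * k)%:E <= \sum_(eps : {ffun grid -> bool}) e)%E.
  apply: (@le_trans _ _ (\sum_(eps : {ffun grid -> bool})
    \int[P]_w L1_dist (run (A w) (fooling eps)) (fooling eps))%E); last first.
    apply: lee_sum => eps _; apply: ereal_sup_ubound.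
    by exists (fooling eps) => //; exact: Fmon_fooling.
  rewrite -ge0_integral_sum; last 3 first.
  - exact: measurableT.
  - by move=> eps; apply: mA; exact: Fmon_fooling.
  - by move=> eps w _; apply: integral_ge0 => x _; rewrite lee_fin.
  rewrite -[leLHS]mule1 -(@probability_setT _ _ _ P) -integral_cst //.
  apply: ge0_le_integral_nomeas => w _; last exact: sum_L1_dist_fooling.
  by rewrite lee_fin mulr_ge0 // invr_ge0 mulr_ge0 // ltW.
(* Nonnegativity excludes the value [-oo] before the factor [F] is cancelled. *)
have : (0 <= e)%E.
  apply: (@le_trans _ _ (\int[P]_w L1_dist (run (A w) (fooling [ffun=> true]))
                                   (fooling [ffun=> true]))%E).
    by apply: integral_ge0 => w _; apply: integral_ge0 => x _; rewrite lee_fin.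
  apply: ereal_sup_ubound.
  by exists (fooling [ffun=> true]) => //; exact: Fmon_fooling.
case: e => [e| |] // _; last by rewrite leey.
by rewrite sumEFin sumr_const !lee_fin -[leRHS]mulr_natl ler_pM2l.
Qed.

Lemma e_ran_ge n : (2 * n <= N.+1 ^ d)%N ->
  (((2 * (d * N.+1)%:R)^-1)%:E <= e_ran R d n)%E.
Proof.
move=> nN; apply: le_ereal_inf_tmp => _ [dsp [T [P [A [mA ->]]]]].
exact: mc_error_ge.
Qed.

End fooling.

(** * Comparison of the two errors and the rate in [n] *)

(** A deterministic algorithm is a Monte Carlo method over a one-point probability space. *)
Lemma e_ran_le_det (R : realType) (d n : nat) : (e_ran R d n <= e_det R d n)%E.
Proof.
apply: le_ereal_inf_tmp => _ [A _ <-]; apply: ereal_inf_lbound.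
exists _, unit, (\d_tt : probability unit R), (fun=> A); split.
  by move=> f _; exact: measurable_cst.
congr ereal_sup; apply/seteqP; split => _ [f fmon <-]; exists f => //.
  by rewrite integral_cst //= diracT mule1.
by rewrite integral_cst //= diracT mule1.
Qed.

(** [N.+1] is the integer part of the [d]-th root of [n]. *)
Lemma root_floor (d n : nat) : (0 < d)%N -> (0 < n)%N ->
  exists N, (N.+1 ^ d <= n < N.+2 ^ d)%N.
Proof.
move=> d0 n0; pose P k := (k.+1 ^ d <= n)%N.
have exP : exists k, P k by exists 0%N; rewrite /P exp1n.
have ubP k : P k -> (k <= n)%N.
  by apply: leq_trans; rewrite (leq_trans (leqnSn k)) // -{1}[k.+1]expn1 leq_pexp2l.
case: (ex_maxnP exP ubP) => N PN maxN; exists N; rewrite [X in X && _]PN /=.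
by rewrite ltnNge; apply/negP => /maxN; rewrite ltnn.
Qed.

Lemma powR_root_bounds (R : realType) (d n N : nat) : (0 < d)%N ->
  (N.+1 ^ d <= n < N.+2 ^ d)%N ->
  N.+2%:R^-1 <= (n%:R : R) `^ (- d%:R^-1) <= N.+1%:R^-1.
Proof.
move=> d0 /andP[Nn nN].
have powE k : (k ^ d)%N%:R `^ d%:R^-1 = k%:R :> R.
  by rewrite natrX -powR_mulrn // -powRrM divff ?powRr1 // pnatr_eq0 -lt0n.
have n0 : (0 < n)%N by apply: leq_trans Nn; rewrite expn_gt0.
rewrite powRN !lef_pV2 ?posrE ?powR_gt0 ?ltr0n //.
rewrite -(powE N.+1) -(powE N.+2) !ge0_ler_powR ?nnegrE ?invr_ge0 //.
- by rewrite ler_nat.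
- by rewrite ler_nat ltnW.
Qed.

Lemma e_det_rate (R : realType) (d n : nat) : (0 < d)%N -> (0 < n)%N ->
  (e_det R d n <= (4 * d%:R)%:E * (n%:R `^ (- d%:R^-1))%:E)%E.
Proof.
move=> d0 n0; have [N Nn] := root_floor d0 n0.
have /andP[r _] := powR_root_bounds R d0 Nn; case/andP: Nn => Nn _.
apply: le_trans (e_det_le R Nn) _; rewrite -EFinM lee_fin.
(* Since [N.+2 <= 2 * N.+1], passing from [N.+1] to [N.+2] in the denominator doubles the constant
   [2 * d] at most. *)
apply: le_trans (ler_wpM2l _ r) => //.
rewrite ler_pdivlMr ?ltr0n // mulrAC ler_pdivrMr ?ltr0n //.
have d1 : 0 <= d%:R :> R by [].
have -> : 4 * d%:R * N.+1%:R = 2 * d%:R * (2 * N.+1)%:R :> R by rewrite natrM; ring.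
by rewrite ler_wpM2l ?mulr_ge0 // ler_nat mulnSr mul2n -addnn addn2 !ltnS leq_addl.
Qed.

Lemma e_ran_rate (R : realType) (d n : nat) : (0 < d)%N -> (0 < n)%N ->
  ((n%:R `^ (- d%:R^-1))%:E <= (8 * d%:R)%:E * e_ran R d n)%E.
Proof.
move=> d0 n0; have [N Nn] := root_floor d0 n0.
have /andP[_ r] := powR_root_bounds R d0 Nn; case/andP: Nn => _ Nn.
(* The grid has [4 * N.+1] segments per axis: one factor 2 gives [2 <= 2 ^ d], the other
   [N.+2 <= 2 * N.+1]. The 4 turns [2 * d] into [8 * d]. *)
have n_le : (2 * n <= (4 * N + 3).+1 ^ d)%N.
  rewrite (_ : (4 * N + 3).+1 = 2 * (2 * N.+1))%N; last by rewrite mulnA mulnSr addn4 addn3.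
  rewrite expnMn leq_mul //; first by rewrite -{1}[2%N]expn1 leq_pexp2l.
  by rewrite (leq_trans (ltnW Nn)) // leq_exp2r // mulnSr mul2n -addnn addn2 !ltnS leq_addl.
have := e_ran_ge R d0 n_le.
rewrite -(@lee_pmul2l _ (8 * d%:R)%:E) // ?lte_fin ?mulr_gt0 ?ltr0n //.
apply: le_trans; rewrite -EFinM lee_fin; apply: le_trans r _.
have -> : (2 * (d * (4 * N + 3).+1)%:R)^-1 = (8 * d%:R)^-1 * N.+1%:R^-1 :> R.
  rewrite -invfM; congr (_^-1); rewrite (_ : (4 * N + 3).+1 = 4 * N.+1)%N.
    by rewrite !natrM; ring.
  by rewrite mulnSr addn4 addn3.
by rewrite mulVKf // mulf_neq0 // pnatr_eq0 -?lt0n.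
Qed.

Theorem theorem2p1 (R : realType) (d : nat) (hd : (0 < d)%N) :
  asymp (@e_ran R d) (@e_det R d) /\
  asymp (@e_det R d) (fun n : nat => (n%:R `^ (- d%:R^-1))%:E).
Proof.
have d0 : 0 < d%:R :> R by rewrite ltr0n.
have le_ran := @e_ran_le_det R d.
split; split.
- by exists 1; split=> // n _; rewrite mul1e.
(* The constants of the upper and the lower rate multiply, as the two bounds are chained through the
   power of [n]. *)
- exists (4 * d%:R * (8 * d%:R)); split=> [|n n0]; first by rewrite !mulr_gt0.
  apply: le_trans (e_det_rate R hd n0) _.
  rewrite [in leRHS]EFinM -muleA lee_pmul2l ?lte_fin ?mulr_gt0 //.
  exact: e_ran_rate.
- exists (4 * d%:R); split=> [|n n0]; first by rewrite mulr_gt0.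
  exact: e_det_rate.
- exists (8 * d%:R); split=> [|n n0]; first by rewrite mulr_gt0.
  apply: le_trans (e_ran_rate R hd n0) _.
  by rewrite lee_pmul2l ?lte_fin ?mulr_gt0.
Qed.
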